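(* Let $\alpha,r\in\mathbb{R}$. (1) If $1\le r\le2$ and $\frac12\le\alpha\le1$, then $K_r\preceq L_\alpha$. (2) If $0\le r\le1$ and $0\le\alpha\le\frac12$, then $L_\alpha\preceq K_r$.
   Context: For $a,b>0$: $K_r(a,b)=\left(\sqrt{ab}\right)^r\left(\frac{a+b}{2}\right)^{1-r}$ ($0\le r\le2$), and the Lehmer mean is $L_\alpha(a,b)=\dfrac{a^\alpha+b^\alpha}{a^{\alpha-1}+b^{\alpha-1}}$ ($0\le\alpha\le1$). For symmetric homogeneous means $N_1,N_2$, the relation $N_1\preceq N_2$ means that the function $t\mapsto N_1(e^t,1)/N_2(e^t,1)$ is positive definite on $\mathbb{R}$, where $f:\mathbb{R}\to\mathbb{C}$ is positive definite if the matrix $[f(t_i-t_j)]_{i,j=1,\dots,n}$ is positive semi-definite for all $n\in\mathbb{N}$ and $t_1,\dots,t_n\in\mathbb{R}$. *)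

(* Defs.v *)
From HB Require Import structures.
From mathcomp Require Import all_boot all_order all_algebra.
From mathcomp Require Import complex.
From mathcomp Require Import reals sequences exp.

Set Implicit Arguments.
Unset Strict Implicit.
Unset Printing Implicit Defensive.

Import Order.TTheory GRing.Theory Num.Theory.

Local Open Scope ring_scope.
Local Open Scope complex_scope.

(* In R[i], [0 <= z] means that z is real and nonnegative, so that a
   positive semi-definite matrix is in particular Hermitian. *)
Definition psdmx (R : realType) (n : nat) (A : 'M[R[i]]_n) : Prop :=
  forall x : 'cV[R[i]]_n, 0 <= ((map_mx Num.conj x)^T *m A *m x) 0 0.

Definition positive_definite (R : realType) (f : R -> R[i]) : Prop :=
  forall (n : nat) (t : 'I_n -> R), psdmx (\matrix_(i, j) f (t i - t j)).

(* Means are represented by total functions of two real arguments; only their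
   values at positive arguments are meaningful. *)
Definition preceq (R : realType) (N1 N2 : R -> R -> R) : Prop :=
  positive_definite (fun t : R => (N1 (expR t) 1 / N2 (expR t) 1)%:C).

Definition K (R : realType) (r : R) (a b : R) : R :=
  (Num.sqrt (a * b)) `^ r * ((a + b) / 2) `^ (1 - r).

Definition L (R : realType) (alpha : R) (a b : R) : R :=
  (a `^ alpha + b `^ alpha) / (a `^ (alpha - 1) + b `^ (alpha - 1)).

(* Main.v *)
Require Import Defs.
From mathcomp Require Import all_boot all_order all_algebra.
From mathcomp Require Import reals.
From mathcomp Require Import complex boolp classical_sets topology normedtype.
From mathcomp Require Import sequences derive realfun exp.
From mathcomp Require Import ring lra.

(** Put [x = t / 2].  Then [K r (e^t) 1 = e^x * cosh x `^ (1 - r)] and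
    [L alpha (e^t) 1 = e^x * cosh (alpha x) / cosh ((1 - alpha) x)], so in both
    parts the quotient of the two means is
    [cosh (b x) / cosh (a x) * cosh x `^ (- s)] with [0 <= b <= a], [0 < a] and
    [0 <= s]: one takes [a, b, s := alpha, 1 - alpha, r - 1] in part (1) and
    [a, b, s := 1 - alpha, alpha, 1 - r] in part (2).  It remains to see that
    the two factors are positive definite and that their product is.

    Products are handled without factoring matrices: a kernel is called a
    [psd_multiplier] when entrywise multiplication by it preserves positive
    semi-definiteness.  Multipliers are trivially stable under products, and
    they are stable under sums and pointwise limits; the rank one kernels
    [v i * v j] are multipliers, and every multiplier is itself positive
    semi-definite, as one sees by multiplying the all-ones kernel.

    The power of cosh ([psd_multiplier_cosh_powR]).  Since
    [cosh (x - y) = cosh x * cosh y * (1 - tanh x * tanh y)], only the kernel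
    [(1 - u i * u j) `^ (- s)] with [`|u i| < 1] matters.  It is the exponential
    of [s * \sum_k (u i * u j) ^+ k / k], and both power series have nonnegative
    coefficients.

    The quotient ([psd_multiplier_cosh_div]).  After rescaling, [a = 1] and
    [0 <= b <= 1].  The endpoints [b = 0] and [b = 1] give [1 / cosh x] and [1].
    The addition formula gives
    [cosh ((b + c) / 2 * x) =
       (cosh (b x) + cosh (c x)) / (2 * cosh ((b - c) / 2 * x))],
    and [1 / cosh] is a multiplier, so the set of good [b] is stable under
    midpoints; being closed, it is all of [0, 1]. *)

Import Order.TTheory GRing.Theory Num.Theory.
Import numFieldNormedType.Exports.
Local Open Scope ring_scope.
Local Open Scope classical_set_scope.

Set Implicit Arguments.
Unset Strict Implicit.

(** * Multipliers of positive semi-definite kernels *)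

(** Symmetry is not part of this notion: only the values of the quadratic form
    on real vectors matter until [psdmx_real]. *)
Definition psd_kernel (R : realType) (I : finType) (A : I -> I -> R) : Prop :=
  forall x : I -> R, 0 <= \sum_i \sum_j x i * x j * A i j.

(** For symmetric kernels the Schur product theorem says that this is the same
    as being positive semi-definite; taking the conclusion of that theorem as
    the definition makes stability under products immediate. *)
Definition psd_multiplier (R : realType) (I : finType) (A : I -> I -> R) :
    Prop :=
  forall B, psd_kernel B -> psd_kernel (fun i j => A i j * B i j).

Lemma eq_psd_multiplier (R : realType) (I : finType) (A A' : I -> I -> R) :
  A =2 A' -> psd_multiplier A -> psd_multiplier A'.
Proof. by move=> /funeq2P ->. Qed.

Lemma psd_kernel_rank1 (R : realType) (I : finType) (v : I -> R) :
  psd_kernel (fun i j => v i * v j).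
Proof.
move=> x; suff -> : \sum_i \sum_j x i * x j * (v i * v j) =
    (\sum_i x i * v i) ^+ 2 by exact: sqr_ge0.
rewrite expr2 mulr_suml; apply: eq_bigr => i _.
by rewrite mulr_sumr; apply: eq_bigr => j _; ring.
Qed.

Lemma psd_multiplierM (R : realType) (I : finType) (A1 A2 : I -> I -> R) :
  psd_multiplier A1 -> psd_multiplier A2 ->
  psd_multiplier (fun i j => A1 i j * A2 i j).
Proof.
move=> m1 m2 B psdB x; have := m1 _ (m2 _ psdB) x.
congr (_ <= _); apply: eq_bigr => i _; apply: eq_bigr => j _; ring.
Qed.

(** The all-ones kernel is positive semi-definite and neutral for the entrywise
    product. *)
Lemma psd_multiplier_psd (R : realType) (I : finType) (A : I -> I -> R) :
  psd_multiplier A -> psd_kernel A.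
Proof.
move=> mA x; have := mA _ (psd_kernel_rank1 (fun=> 1)) x.
congr (_ <= _); apply: eq_bigr => i _; apply: eq_bigr => j _; ring.
Qed.

Lemma psd_multiplierD (R : realType) (I : finType) (A1 A2 : I -> I -> R) :
  psd_multiplier A1 -> psd_multiplier A2 ->
  psd_multiplier (fun i j => A1 i j + A2 i j).
Proof.
move=> m1 m2 B psdB x.
under eq_bigr do under eq_bigr do rewrite mulrDl mulrDr.
under eq_bigr do rewrite big_split.
by rewrite big_split addr_ge0 //; [apply: m1 | apply: m2].
Qed.

(** Multiplying the kernel by [v i * v j] amounts to rescaling the test
    vector. *)
Lemma psd_multiplier_rank1 (R : realType) (I : finType) (v : I -> R) :
  psd_multiplier (fun i j => v i * v j).
Proof.
move=> B psdB x; have := psdB (fun i => x i * v i).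
congr (_ <= _); apply: eq_bigr => i _; apply: eq_bigr => j _; ring.
Qed.

Lemma psd_multiplier_cst (R : realType) (I : finType) (c : R) :
  0 <= c -> psd_multiplier (fun _ _ : I => c).
Proof.
move=> c0; have := psd_multiplier_rank1 (fun=> Num.sqrt c).
by rewrite -expr2 sqr_sqrtr.
Qed.

(** For a fixed kernel and a fixed test vector, the quadratic form is a finite
    sum, hence continuous in the entries of the multiplier. *)
Lemma psd_multiplier_lim (R : realType) (I : finType)
    (A_ : nat -> I -> I -> R) (A : I -> I -> R) :
  (forall n, psd_multiplier (A_ n)) ->
  (forall i j, A_ n i j @[n --> \oo] --> A i j) -> psd_multiplier A.
Proof.
move=> mA cvA B psdB x.
have cv : (\sum_i \sum_j x i * x j * (A_ n i j * B i j)) @[n --> \oo] -->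
    \sum_i \sum_j x i * x j * (A i j * B i j).
  apply: cvg_big => [|i _]; first exact: add_continuous.
  apply: cvg_big => [|j _]; first exact: add_continuous.
  apply: cvgM; first exact: cvg_cst.
  by apply: cvgM; [exact: cvA | exact: cvg_cst].
apply: (cvgr_to_ge cv); apply: nearW => n; exact: mA.
Qed.

Lemma psd_multiplier_power_series (R : realType) (I : finType) (c : nat -> R)
    (Z A : I -> I -> R) :
  (forall k, 0 <= c k) -> psd_multiplier Z ->
  (forall i j, series (fun k => c k * Z i j ^+ k) @ \oo --> A i j) ->
  psd_multiplier A.
Proof.
move=> c0 mZ cvA.
have mX k : psd_multiplier (fun i j => Z i j ^+ k).
  elim: k => [|k IH]; first exact: psd_multiplier_cst.
  apply: eq_psd_multiplier (psd_multiplierM mZ IH) => i j.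
  by rewrite exprS.
have mS n : psd_multiplier
    (fun i j => series (fun k => c k * Z i j ^+ k) n).
  elim: n => [|n IH].
    apply: eq_psd_multiplier (psd_multiplier_cst (lexx (0 : R))) => i j.
    by rewrite /series/= big_nil.
  apply: (eq_psd_multiplier _ (psd_multiplierD IH
    (psd_multiplierM (psd_multiplier_cst (c0 n)) (mX n)))) => i j.
  by rewrite /series/= big_nat_recr.
exact: psd_multiplier_lim mS cvA.
Qed.

Lemma psd_multiplier_expR (R : realType) (I : finType) (A : I -> I -> R) :
  psd_multiplier A -> psd_multiplier (fun i j => expR (A i j)).
Proof.
move=> mA.
apply: (psd_multiplier_power_series (c := fun k => k`!%:R^-1) (Z := A)) => //.
  by move=> k; rewrite invr_ge0.
move=> i j; have := is_cvg_series_exp_coeff (A i j).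
by rewrite /expR exp_coeffE.
Qed.

(** * The kernels (1 - u i * u j) ^ (- s) *)

(** The Mercator series.  The derivative of the remainder
    [- ln (1 - x) - \sum_(1 <= k <= n) x ^+ k / k] is the tail
    [x ^+ n / (1 - x)] of the geometric series, so by the mean value theorem the
    remainder at [z] is at most [`|z| ^+ n.+1 / (1 - `|z|)].  The term of index
    [0] of the series vanishes because [0^-1 = 0]. *)
Lemma ln_series (R : realType) (z : R) : `|z| < 1 ->
  series (fun k => k%:R^-1 * z ^+ k) @ \oo --> - ln (1 - z).
Proof.
move=> z1.
pose q n : {poly R} := \sum_(k < n) (k.+1%:R^-1 *: 'X^(k.+1)).
have qE n x : (q n).[x] = series (fun k => k%:R^-1 * x ^+ k) n.+1.
  rewrite /series/= big_mkord big_ord_recl invr0 mul0r add0r horner_sum.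
  by apply: eq_bigr => k _; rewrite !hornerE.
have dq n x : (q n)^`().[x] = \sum_(k < n) x ^+ k.
  rewrite raddf_sum horner_sum; apply: eq_bigr => k _ /=.
  rewrite derivZ derivXn hornerZ hornerMn hornerXn -[_ ^+ _ *+ _]mulr_natl mulrA.
  by rewrite mulVf ?mul1r // pnatr_eq0.
pose f n x := - ln (1 - x) - (q n).[x].
have f0 n : f n 0 = 0.
  rewrite /f subr0 ln1 oppr0 sub0r qE /series/= big_mkord big_ord_recl.
  rewrite invr0 mul0r add0r big1 ?oppr0 // => k _.
  by rewrite expr0n mulr0.
have df n (x : R) : x < 1 -> is_derive x 1 (f n) (x ^+ n / (1 - x)).
  move=> x1; have x10 : 0 < 1 - x by rewrite subr_gt0.
  have dln : is_derive (1 - x) 1 (@ln R) (1 - x)^-1 by exact: is_derive1_ln.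
  have d1 : is_derive x 1 (fun y : R => 1 - y) (-1).
    have := is_deriveB (is_derive_cst (1 : R) x 1) (is_derive_id x 1).
    by rewrite sub0r.
  have d2 : is_derive x 1 (fun y => ln (1 - y)) (- (1 - x)^-1).
    have := @is_derive1_comp _ (@ln R) (fun y : R => 1 - y) _ _ _ dln d1.
    by rewrite mulrN1.
  have := is_deriveB (is_deriveN d2) (is_derive_poly (q n) x).
  rewrite opprK dq.
  have -> // : (1 - x)^-1 - \sum_(i < n) x ^+ i = x ^+ n / (1 - x).
  apply: (mulIf (lt0r_neq0 x10)); rewrite mulrBl mulVf ?divfK ?lt0r_neq0 //.
  by have := subrX1 x n => e; rewrite -(opprB x 1) mulrN opprK mulrC -e; ring.
have cf n (x : R) : x < 1 -> {for x, continuous (f n)}.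
  move=> x1; have := df n x x1 => -[fx _].
  exact/differentiable_continuous/derivable1_diffP.
have bound n : `|f n z| <= `|z| ^+ n * (`|z| / (1 - `|z|)).
  have b c : `|c| <= `|z| ->
      `|c ^+ n / (1 - c) * z| <= `|z| ^+ n * (`|z| / (1 - `|z|)).
    move=> cz; have c1 : c < 1 by apply: le_lt_trans (ler_norm _) _; lra.
    have := ler_norm c => cc.
    rewrite normrM normrM normrX normfV (gtr0_norm (_ : 0 < 1 - c)) ?subr_gt0 //.
    rewrite -mulrA [_^-1 * _]mulrC; apply: ler_pM => //.
    - exact: exprn_ge0.
    - by rewrite divr_ge0 //; lra.
    - exact: lerXn2r.
    - by apply: ler_wpM2l => //; rewrite lef_pV2 ?posrE; lra.
  have [z0|z0] := leP 0 z.
    have [||c] := @MVT_segment R (f n) (fun x => x ^+ n / (1 - x)) 0 z z0.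
    - move=> x; rewrite in_itv /= => /andP[x0 xz]; apply: df.
      by rewrite (lt_trans xz) // -(ger0_norm z0).
    - apply: continuous_in_subspaceT => x; rewrite inE /= in_itv /=.
      move=> /andP[x0 xz]; apply: cf.
      by rewrite (le_lt_trans xz) // -(ger0_norm z0).
    rewrite in_itv /= f0 !subr0 => /andP[c0 cz] ->.
    by apply: b; rewrite !ger0_norm.
  have [||c] := @MVT_segment R (f n) (fun x => x ^+ n / (1 - x)) z 0 (ltW z0).
  - move=> x; rewrite in_itv /= => /andP[x0 xz]; apply: df.
    by rewrite (lt_trans xz).
  - apply: continuous_in_subspaceT => x; rewrite inE /= in_itv /=.
    by move=> /andP[x0 xz]; apply: cf; rewrite (le_lt_trans xz).
  rewrite in_itv /= f0 !sub0r mulrN => /andP[c0 cz] /oppr_inj ->.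
  by apply: b; rewrite !ler0_norm // ?lerN2 // ltW.
rewrite -cvg_shiftS.
have cvf : f ^~ z @ \oo --> 0.
  apply/norm_cvg0P; apply: (@squeeze_cvgr _ _ _ _ (fun=> 0)
    (fun n => `|z| ^+ n * (`|z| / (1 - `|z|)))).
  - by apply: nearW => n; rewrite normr_ge0 /=.
  - exact: cvg_cst.
  - rewrite -(mul0r (`|z| / (1 - `|z|))); apply: cvgMr_tmp.
    by apply: cvg_expr; rewrite normr_id.
have -> : [sequence series (fun k => k%:R^-1 * z ^+ k) n.+1]_n =
    (fun n => - ln (1 - z) - f n z).
  by apply/funext => n; rewrite /= -qE /f; ring.
rewrite -[- ln (1 - z)]subr0.
by apply: cvgB => //; rewrite subr0; exact: cvg_cst.
Qed.

(** This is the exponential of [s * - ln (1 - u i * u j)], whose exponent is a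
    power series with nonnegative coefficients in a rank one kernel. *)
Lemma psd_multiplier_1subM_powRN (R : realType) (I : finType) (u : I -> R)
    (s : R) : 0 <= s -> (forall i, `|u i| < 1) ->
  psd_multiplier (fun i j => (1 - u i * u j) `^ (- s)).
Proof.
move=> s0 u1.
have uu i j : `|u i * u j| < 1 by rewrite normrM mulr_ilt1.
have mln : psd_multiplier (fun i j => - ln (1 - u i * u j)).
  apply: (psd_multiplier_power_series (c := fun k => k%:R^-1)
    (Z := fun i j => u i * u j)).
  - by move=> k; rewrite invr_ge0.
  - exact: psd_multiplier_rank1.
  - by move=> i j; exact: ln_series.
apply: eq_psd_multiplier
  (psd_multiplier_expR (psd_multiplierM (psd_multiplier_cst s0) mln)) => i j.
have : u i * u j < 1 by apply: le_lt_trans (ler_norm _) _.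
rewrite -subr_gt0 /powR => /lt0r_neq0/negPf ->.
by rewrite mulrN mulNr.
Qed.

(** * Powers of the hyperbolic cosine *)

Definition cosh (R : realType) (x : R) : R := (expR x + expR (- x)) / 2.

Lemma cosh_gt0 (R : realType) (x : R) : 0 < cosh x.
Proof. by rewrite divr_gt0 // addr_gt0 ?expR_gt0. Qed.

Lemma coshN (R : realType) (x : R) : cosh (- x) = cosh x.
Proof. by rewrite /cosh opprK addrC. Qed.

Lemma cosh0 (R : realType) : cosh (0 : R) = 1.
Proof. by rewrite /cosh oppr0 expR0; field. Qed.

Lemma coshD_coshB (R : realType) (x y : R) :
  cosh (x + y) + cosh (x - y) = 2 * cosh x * cosh y.
Proof.
by rewrite /cosh !opprD opprK !expRD; field.
Qed.

Lemma continuous_cosh (R : realType) : continuous (@cosh R).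
Proof.
move=> x; apply: cvgM; last exact: cvg_cst.
apply: cvgD; first exact: continuous_expR.
apply: continuous_comp; last exact: continuous_expR.
exact: opp_continuous.
Qed.

(** With [u i = tanh (t i)], the kernel [cosh (t i - t j)] is the rank one kernel
    [cosh (t i) * cosh (t j)] times [1 - u i * u j], and [`|u i| < 1]. *)
Lemma psd_multiplier_cosh_powR (R : realType) (I : finType) (t : I -> R)
    (s : R) : 0 <= s -> psd_multiplier (fun i j => cosh (t i - t j) `^ (- s)).
Proof.
move=> s0.
pose u i := (expR (t i) - expR (- t i)) / (expR (t i) + expR (- t i)).
have p0 i : 0 < expR (t i) by exact: expR_gt0.
have m0 i : 0 < expR (- t i) by exact: expR_gt0.
have u1 i : `|u i| < 1.
  have d0 : 0 < expR (t i) + expR (- t i) by rewrite addr_gt0.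
  rewrite normrM normfV (gtr0_norm d0) ltr_pdivrMr // mul1r ltr_norml.
  by have := p0 i; have := m0 i; lra.
have coshE i j : cosh (t i - t j) =
    cosh (t i) * cosh (t j) * (1 - u i * u j).
  rewrite /cosh /u opprB !expRD.
  field; rewrite !lt0r_neq0 ?addr_gt0 //.
apply: eq_psd_multiplier (psd_multiplierM
  (psd_multiplier_rank1 (fun i => cosh (t i) `^ (- s)))
  (psd_multiplier_1subM_powRN s0 u1)) => i j.
have c0 i' := ltW (cosh_gt0 (t i')).
have cc0 := mulr_ge0 (c0 i) (c0 j).
have uu0 : 0 <= 1 - u i * u j.
  rewrite subr_ge0 (le_trans (ler_norm _)) // normrM.
  by rewrite mulr_ile1 // ltW.
by rewrite coshE (powRM _ cc0 uu0) (powRM _ (c0 i) (c0 j)).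
Qed.

(** * Quotients of hyperbolic cosines *)

(** Midpoints yield all dyadic rationals of the unit interval, and these are
    dense. *)
Lemma midpoint_closed_unit_itv (R : realType) (P : R -> Prop) :
  P 0 -> P 1 -> (forall x y, P x -> P y -> P ((x + y) / 2)) ->
  (forall (u : nat -> R) (l : R), (forall n, P (u n)) -> u @ \oo --> l -> P l) ->
  forall b : R, 0 <= b <= 1 -> P b.
Proof.
move=> P0 P1 Pmid Plim b /andP[b0 b1].
have dyadic n k : (k <= 2 ^ n)%N -> P (k%:R / 2 ^+ n).
  elim: n k => [|n IH] k.
    by rewrite expn0 expr0 divr1; case: k => [|[|]].
  (* [k / 2 ^ n.+1] is the midpoint of the fractions over [2 ^ n] whose
     numerators are the two halves of [k], rounded down and up. *)
  have e : k = (k./2 + uphalf k)%N.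
    by rewrite uphalf_half addnCA addnn odd_double_half.
  move=> kn; have k1 : (uphalf k <= 2 ^ n)%N.
    by rewrite leq_uphalf_double -mul2n -expnS.
  have k2 : (k./2 <= 2 ^ n)%N.
    by rewrite (leq_trans _ k1) // uphalf_half leq_addl.
  have := Pmid _ _ (IH _ k2) (IH _ k1).
  by rewrite -mulrDl -natrD -e -mulrA -invfM -exprSr.
pose d n := (Num.trunc (b * 2 ^+ n))%:R / 2 ^+ n : R.
have two0 n : 0 < 2 ^+ n :> R by rewrite exprn_gt0.
have bn n : 0 <= b * 2 ^+ n by rewrite mulr_ge0 // ltW.
apply: (Plim d) => [n|].
  apply: dyadic; rewrite -(ler_nat R) natrX.
  apply: le_trans (_ : b * 2 ^+ n <= _); first by rewrite truncn_le.
  by rewrite ler_piMl // ltW.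
apply: (@squeeze_cvgr _ _ _ _ (fun n => b - 2^-1 ^+ n) (fun=> b)).
- apply: nearW => n; have /andP[l u] := truncn_itv (bn n).
  rewrite ler_pdivrMr // l andbT ler_pdivlMr // mulrBl.
  by rewrite -exprMn mulVf ?pnatr_eq0 // expr1n lerBlDr natr1 ltW.
- have -> : (fun n => b - 2^-1 ^+ n) @ \oo --> b =
      ((fun n => b - 2^-1 ^+ n) @ \oo --> b - 0) by rewrite subr0.
  apply: cvgB; first exact: cvg_cst.
  by apply: cvg_expr; rewrite ger0_norm ?invr_ge0 // invf_lt1 // ltr1n.
- exact: cvg_cst.
Qed.

(** The set of good [b] contains [0] and [1], is closed, and is stable under
    midpoints because
    [cosh (x z) + cosh (y z) = 2 * cosh ((x + y) / 2 * z) * cosh ((x - y) / 2 * z)]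
    and the last factor has a multiplier as its inverse. *)
Lemma psd_multiplier_cosh_div (R : realType) (I : finType) (t : I -> R)
    (b : R) : 0 <= b <= 1 ->
  psd_multiplier (fun i j => cosh (b * (t i - t j)) / cosh (t i - t j)).
Proof.
have mV c : psd_multiplier (fun i j => (cosh (c * (t i - t j)))^-1).
  apply: eq_psd_multiplier
    (psd_multiplier_cosh_powR (fun i => c * t i) ler01) => i j.
  by rewrite powR_inv1 ?mulrBr // ltW ?cosh_gt0.
pose P b := psd_multiplier
  (fun i j => cosh (b * (t i - t j)) / cosh (t i - t j)).
apply: (@midpoint_closed_unit_itv R P); rewrite {}/P.
- apply: (eq_psd_multiplier _ (mV 1)) => i j.
  by rewrite mul0r cosh0 !mul1r.
- apply: (eq_psd_multiplier _ (psd_multiplier_cst (@ler01 R))) => i j.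
  by rewrite mul1r divff // lt0r_neq0 ?cosh_gt0.
- move=> x y Px Py.
  have h0 : 0 <= 2^-1 :> R by rewrite invr_ge0.
  apply: eq_psd_multiplier (psd_multiplierM (psd_multiplierM
    (psd_multiplier_cst h0) (psd_multiplierD Px Py)) (mV ((x - y) / 2))) => i j.
  set z := t i - t j.
  have -> : cosh (x * z) = cosh ((x + y) / 2 * z + (x - y) / 2 * z).
    by congr cosh; field.
  have -> : cosh (y * z) = cosh ((x + y) / 2 * z - (x - y) / 2 * z).
    by congr cosh; field.
  rewrite -mulrDl coshD_coshB; field.
  by rewrite !lt0r_neq0 ?cosh_gt0.
- move=> u l Pu ul; apply: (psd_multiplier_lim Pu) => i j.
  apply: cvgM; last exact: cvg_cst.
  apply: (@cvg_comp _ _ _ (fun n => u n * (t i - t j)) (@cosh R));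
    last exact: continuous_cosh.
  by apply: cvgM; [exact: ul | exact: cvg_cst].
Qed.

(** * Comparison of the means *)

(** For a vector [u + i v] the Hermitian form of a real symmetric kernel is the
    sum of its quadratic forms at [u] and at [v]: symmetry cancels the imaginary
    part. *)
Lemma psdmx_real (R : realType) (n : nat) (A : 'I_n -> 'I_n -> R) :
  psd_kernel A -> (forall i j, A i j = A j i) ->
  psdmx (\matrix_(i, j) (A i j)%:C%C).
Proof.
move=> psdA symA x.
pose u i := complex.Re (x i 0); pose v i := complex.Im (x i 0).
have sumE (F G : 'I_n -> R) : \sum_i (F i +i* G i)%C =
    ((\sum_i F i) +i* (\sum_i G i))%C.
  by elim/big_rec3: _ => // i a b c _ ->.
rewrite !mxE.
under eq_bigr => j _.
  rewrite mxE mulr_suml; under eq_bigr => i _.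
    have -> : (map_mx Num.conj x)^T 0 i * (\matrix_(i, j) (A i j)%:C%C) i j *
        x j 0 = ((u i * u j + v i * v j) * A i j +i*
                 ((u i * v j - v i * u j) * A i j))%C.
      rewrite !mxE /u /v; case: (x i 0) => a b; case: (x j 0) => c d.
      by apply/eqP; rewrite eq_complex /=; apply/andP; split; apply/eqP; ring.
    over.
  rewrite sumE; over.
rewrite sumE lecE /=; apply/andP; split.
  set S := \sum_j _; suff SN : S = - S by apply/eqP; lra.
  rewrite {1}/S exchange_big -sumrN; apply: eq_bigr => i _.
  by rewrite -sumrN; apply: eq_bigr => j _; rewrite symA; ring.
under eq_bigr do under eq_bigr do rewrite mulrDl.
under eq_bigr do rewrite big_split.
rewrite big_split /=; apply: addr_ge0.
  by rewrite exchange_big; exact: psdA.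
by rewrite exchange_big; exact: psdA.
Qed.

Lemma K_expR (R : realType) (r t : R) :
  K r (expR t) 1 = expR (t / 2) * cosh (t / 2) `^ (1 - r).
Proof.
have h : t = t / 2 + t / 2 by lra.
have e : Num.sqrt (expR t) = expR (t / 2).
  by rewrite {1}h expRD -expr2 sqrtr_sqr ger0_norm ?expR_ge0.
have e2 : (expR t + 1) / 2 = expR (t / 2) * cosh (t / 2).
  by rewrite /cosh {1}h expRD mulrA mulrDr expRxMexpNx_1.
have c0 := ltW (cosh_gt0 (t / 2)).
rewrite /K mulr1 e e2 (powRM _ (expR_ge0 _) c0) mulrA -powRD.
  by rewrite addrC subrK powRr1 ?expR_ge0.
by rewrite expR_eq0 implybT.
Qed.

Lemma L_expR (R : realType) (alpha t : R) :
  L alpha (expR t) 1 =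
  expR (t / 2) * (cosh (alpha * (t / 2)) / cosh ((1 - alpha) * (t / 2))).
Proof.
have e (c : R) : expR t `^ c + 1 `^ c =
    2 * expR (c * (t / 2)) * cosh (c * (t / 2)).
  rewrite powR1 -expRM (_ : t * c = c * (t / 2) + c * (t / 2)); last by field.
  set y := c * (t / 2).
  have -> : 2 * expR y * cosh y = expR y * expR y + expR y * expR (- y).
    by rewrite /cosh; field.
  by rewrite expRxMexpNx_1 expRD.
rewrite /L !e -(coshN ((1 - alpha) * _)) -mulNr opprB.
have -> : expR (alpha * (t / 2)) = expR (t / 2) * expR ((alpha - 1) * (t / 2)).
  by rewrite -expRD; congr expR; field.
by field; rewrite !lt0r_neq0 ?cosh_gt0 ?expR_gt0.
Qed.

(** The common form of the two quotients of means, at [x = t i - t j]. *)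
Lemma psdmx_cosh_quotient (R : realType) (n : nat) (t : 'I_n -> R)
    (a b s : R) : 0 < a -> 0 <= b <= a -> 0 <= s ->
  psdmx (\matrix_(i, j)
    (cosh (b * (t i - t j)) / cosh (a * (t i - t j)) *
     cosh (t i - t j) `^ (- s))%:C%C).
Proof.
move=> a0 /andP[b0 ba] s0; apply: psdmx_real => [|i j].
  apply: psd_multiplier_psd; apply: psd_multiplierM.
    have ba1 : 0 <= b / a <= 1.
      by rewrite divr_ge0 ?(ltW a0) //= ler_pdivrMr // mul1r.
    apply: eq_psd_multiplier
      (psd_multiplier_cosh_div (fun i => a * t i) ba1) => i j.
    by rewrite -mulrBr mulrA divfK // lt0r_neq0.
  exact: psd_multiplier_cosh_powR.
by rewrite -(opprB (t j)) !mulrN !coshN.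
Qed.

Theorem proposition3p3 (R : realType) (alpha r : R) :
  (1 <= r <= 2 -> 1 / 2 <= alpha <= 1 -> preceq (K r) (L alpha)) /\
  (0 <= r <= 1 -> 0 <= alpha <= 1 / 2 -> preceq (L alpha) (K r)).
Proof.
split=> /andP[r0 r1] /andP[a0 a1] n t.
- have agt0 : 0 < alpha by lra.
  have b_le_a : 0 <= 1 - alpha <= alpha by lra.
  have s_ge0 : 0 <= r - 1 by lra.
  have := psdmx_cosh_quotient (fun i => t i / 2) agt0 b_le_a s_ge0.
  congr psdmx; apply/matrixP=> i j; rewrite !mxE K_expR L_expR -mulrBl opprB.
  set x := (t i - t j) / 2; congr (_%:C)%C; field.
  by rewrite !lt0r_neq0 ?cosh_gt0 ?expR_gt0.
- have agt0 : 0 < 1 - alpha by lra.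
  have b_le_a : 0 <= alpha <= 1 - alpha by lra.
  have s_ge0 : 0 <= 1 - r by lra.
  have := psdmx_cosh_quotient (fun i => t i / 2) agt0 b_le_a s_ge0.
  congr psdmx; apply/matrixP=> i j; rewrite !mxE K_expR L_expR -mulrBl powRN.
  set x := (t i - t j) / 2; congr (_%:C)%C; field.
  by rewrite !lt0r_neq0 ?powR_gt0 ?cosh_gt0 ?expR_gt0.
Qed.
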